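(* Let $(X,\mathcal{U},\int)$ be a Daniell space. Let $\mathcal{U}^*$ be the space of all functions $f:X\to\mathbb{R}$ for which there exists a sequence $f_1,f_2,\ldots\in\mathcal{U}$ with $f\simeq\sum_{n=1}^\infty f_n$, and for such $f$ put $\int f=\sum_{n=1}^\infty\int f_n$. Then $(X,\mathcal{U}^*,\int)$ is a complete Daniell space that extends $(X,\mathcal{U},\int)$, i.e. $\mathcal{U}\subset\mathcal{U}^*$ and the integral on $\mathcal{U}^*$ agrees with the given integral on $\mathcal{U}$.
   Context: A Riesz space of real functions on $X$ is a real vector space of functions $X\to\mathbb{R}$ (pointwise operations) closed under pointwise $f\vee g=\max(f,g)$ and $f\wedge g=\min(f,g)$. A Daniell space is a triple $(X,\mathcal{U},\int)$ with $X$ a nonempty set, $\mathcal{U}$ a Riesz space of real-valued functions on $X$, and $\int:\mathcal{U}\to\mathbb{R}$ a linear functional such that (I) $\int f\ge 0$ whenever $f\ge 0$, and (II) $\int f_n\to 0$ for every non-increasing sequence $f_n\in\mathcal{U}$ with $f_n(x)\to 0$ for every $x\in X$. For a function $f:X\to\mathbb{R}$ and $f_1,f_2,\ldots\in\mathcal{U}$, write $f\simeq\sum_{n=1}^\infty f_n$ if (A) $\sum_{n=1}^\infty\int|f_n|<\infty$ and (B) $f(x)=\sum_{n=1}^\infty f_n(x)$ for every $x\in X$ with $\sum_{n=1}^\infty|f_n(x)|<\infty$. A Daniell space $(X,\mathcal{U},\int)$ is complete if $f\simeq\sum_{n=1}^\infty f_n$ for some $f_1,f_2,\ldots\in\mathcal{U}$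 implies $f\in\mathcal{U}$. The value $\int f=\sum_{n=1}^\infty\int f_n$ for $f\in\mathcal{U}^*$ does not depend on the representation $f\simeq\sum_{n=1}^\infty f_n$. *)

(* Defs.v *)
From HB Require Import structures.
From mathcomp Require Import all_boot all_order all_algebra.
From mathcomp Require Import all_classical all_reals all_analysis.

Set Implicit Arguments.
Unset Strict Implicit.
Unset Printing Implicit Defensive.

Import Order.TTheory GRing.Theory Num.Theory.
Import numFieldNormedType.Exports.

Local Open Scope classical_set_scope.
Local Open Scope ring_scope.

Record is_riesz_space (R : realType) (X : Type) (U : set (X -> R)) : Prop := {
  riesz0 : U 0 ;
  rieszD : forall f g, U f -> U g -> U (f + g) ;
  rieszZ : forall (a : R) f, U f -> U (a *: f) ;
  riesz_max : forall f g, U f -> U g -> U (f \max g) ;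
  riesz_min : forall f g, U f -> U g -> U (f \min g) }.

(* The integral is a total function of which only the values on [U] are ever
   used: a linear functional U -> R is represented by any of its extensions. *)
Record is_daniell_space (R : realType) (X : Type) (U : set (X -> R))
    (I : (X -> R) -> R) : Prop := {
  daniell_nonempty : [set: X] !=set0 ;
  daniell_riesz : is_riesz_space U ;
  daniellD : forall f g, U f -> U g -> I (f + g) = I f + I g ;
  daniellZ : forall (a : R) f, U f -> I (a *: f) = a * I f ;
  daniell_ge0 : forall f, U f -> (forall x, 0 <= f x) -> 0 <= I f ;
  daniell_cvg0 : forall fs : nat -> X -> R,
    (forall n, U (fs n)) ->
    (forall x, nonincreasing_seq (fs ^~ x)) ->
    (forall x, fs ^~ x @ \oo --> (0 : R)) ->
    I \o fs @ \oo --> (0 : R) }.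

(* f ≃ \sum_n fs n, sequences being indexed from 0; [series u] is the sequence
   of partial sums of [u]. *)
Record expansion (R : realType) (X : Type) (U : set (X -> R))
    (I : (X -> R) -> R) (f : X -> R) (fs : nat -> X -> R) : Prop := {
  expansion_mem : forall n, U (fs n) ;
  expansion_summable : cvgn (series (fun n => I (fun x => `|fs n x|))) ;
  expansion_cvg : forall x, cvgn (series (fun n => `|fs n x|)) ->
    series (fs ^~ x) @ \oo --> f x }.

Record is_complete_daniell_space (R : realType) (X : Type) (U : set (X -> R))
    (I : (X -> R) -> R) : Prop := {
  complete_daniell : is_daniell_space U I ;
  complete_closed : forall f fs, expansion U I f fs -> U f }.

Definition ext_space (R : realType) (X : Type) (U : set (X -> R))
    (I : (X -> R) -> R) : set (X -> R) :=
  [set f | exists fs, expansion U I f fs].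

(* The sum of the integrals along a chosen expansion of [f] ([get] returns an
   arbitrary value when [f] has no expansion). *)
Definition ext_int (R : realType) (X : Type) (U : set (X -> R))
    (I : (X -> R) -> R) (f : X -> R) : R :=
  get [set r | exists2 fs, expansion U I f fs & r = limn (series (I \o fs))].

(* Main.v *)
Require Import Defs.
(* If an element of U lies below the pointwise limit of a nondecreasing sequence
   t_n of U wherever that limit is finite, then its integral is at most
   sup I(t_n): property (II) applies to the positive parts of f - t_n. Applied
   to the tails of an expansion, this shows that the integral of a nonnegative
   function is nonnegative, hence that it does not depend on the expansion.
   Completeness comes from summing over squares a double family of expansions
   which are sharp, i.e. \sum_k I|f_{n,k}| <= J|F_n| + 2^-n. The same summation
   gives J(F) = \sum_n J(F_n), and property (II) for a sequence F_n decreasing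
   to 0 is that identity for the telescoping expansion of F_0 by the
   differences F_n - F_{n+1}. *)
From HB Require Import structures.
From mathcomp Require Import all_boot all_order all_algebra.
From mathcomp Require Import all_classical all_reals all_analysis.
From mathcomp Require Import lra.

Set Implicit Arguments.
Unset Strict Implicit.
Unset Printing Implicit Defensive.

Import Order.TTheory GRing.Theory Num.Theory.
Import numFieldNormedType.Exports.

Local Open Scope classical_set_scope.
Local Open Scope ring_scope.

(** * Real sequences and Lipschitz bounds *)

Section RealLine.
Variable R : realType.
Implicit Types (u v : nat -> R) (l : R).

Lemma cvg_even_odd u l :
  u n.*2 @[n --> \oo] --> l -> u n.*2.+1 @[n --> \oo] --> l -> u @ \oo --> l.
Proof.
move=> /cvgrPdist_lt ue /cvgrPdist_lt uo; apply/cvgrPdist_lt => e e0.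
have [M _ ueM] := ue _ e0; have [N _ uoN] := uo _ e0.
exists (maxn M N).*2.+1 => // n /= ltMNn.
have le_half : (maxn M N <= n./2)%N by rewrite geq_half_double ltnW.
rewrite -(odd_double_half n); case: (odd n) => /=.
  by rewrite add1n; apply: uoN => /=; apply: leq_trans le_half; exact: leq_maxr.
by rewrite add0n; apply: ueM => /=; apply: leq_trans le_half; exact: leq_maxl.
Qed.

Lemma nondecreasing_le_cvgn u C :
  nondecreasing_seq u -> (forall n, u n <= C) -> cvgn u.
Proof.
by move=> u_nd uC; apply: nondecreasing_is_cvgn => //; exists C => _ [n _ <-].
Qed.

Lemma nondecreasing_normr_series u :
  nondecreasing_seq (series (fun n => `|u n|)).
Proof. by apply/nondecreasing_seqP => n; rewrite seriesSr lerDl. Qed.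

(** The factor [1] is the constant [C] of [approx_lipschitz], through which the extension inherits
    [max]. *)
Lemma max_lipschitz (a b c d : R) :
  `|Num.max a b - Num.max c d| <= 1 * (`|a - c| + `|b - d|).
Proof.
rewrite mul1r ler_norml.
have := lexx `|a - c|; rewrite {1}ler_norml => /andP[].
have := lexx `|b - d|; rewrite {1}ler_norml => /andP[].
have := normr_ge0 (a - c); have := normr_ge0 (b - d).
by case: (leP a b); case: (leP c d) => *; apply/andP; split; lra.
Qed.

Lemma min_lipschitz (a b c d : R) :
  `|Num.min a b - Num.min c d| <= 1 * (`|a - c| + `|b - d|).
Proof.
rewrite mul1r ler_norml.
have := lexx `|a - c|; rewrite {1}ler_norml => /andP[].
have := lexx `|b - d|; rewrite {1}ler_norml => /andP[].
have := normr_ge0 (a - c); have := normr_ge0 (b - d).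
by case: (leP a b); case: (leP c d) => *; apply/andP; split; lra.
Qed.

(** * Double series summed over squares *)

Section DoubleSeries.
Variables (s t : nat -> nat -> R) (F : nat -> R).
Hypothesis s0 : forall n, s n 0%N = 0.
Hypothesis t0 : forall n, t n 0%N = 0.
Hypothesis st : forall n i j, (i <= j)%N -> `|s n j - s n i| <= t n j - t n i.

(** As [s n] lists the partial sums of row [n], this is the sum of the array over the square of its
    first [M] rows and columns. *)
Let S M := \sum_(0 <= n < M) s n M.
Let T M := \sum_(0 <= n < M) t n M.

Let t_nd n : nondecreasing_seq (t n).
Proof. by move=> i j ij; rewrite -subr_ge0 (le_trans _ (st n ij)). Qed.

Let t_ge0 n i : 0 <= t n i.
Proof. by rewrite -(t0 n); exact: t_nd. Qed.

(** Enlarging the square extends the first [i] rows and adds rows [i] to [j - 1], which start from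
    0; [st] bounds each contribution. *)
Lemma square_sum_dist i j : (i <= j)%N -> `|S j - S i| <= T j - T i.
Proof.
move=> ij; rewrite /S /T !(big_cat_nat (leq0n i) ij)/= !(addrAC _ _ (- _)).
rewrite -!sumrB (le_trans (ler_normD _ _))// lerD//.
  by rewrite (le_trans (ler_norm_sum _ _ _))// ler_sum// => n _; exact: st.
rewrite (le_trans (ler_norm_sum _ _ _))// ler_sum// => n _.
by have := st n (leq0n j); rewrite s0 t0 !subr0.
Qed.

Hypothesis T_cvg : cvgn T.

Let T_nd : nondecreasing_seq T.
Proof.
by move=> i j ij; rewrite -subr_ge0 (le_trans _ (square_sum_dist ij)).
Qed.

Let T_le M : T M <= limn T.
Proof. exact: nondecreasing_cvgn_le. Qed.

Let partial_sum_le N M : (N <= M)%N -> \sum_(0 <= n < N) t n M <= T M.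
Proof.
by move=> NM; rewrite /T (big_cat_nat (leq0n N) NM)/= lerDl sumr_ge0.
Qed.

(** Every square with side at least [n.+1] contains a piece of row [n], so nonnegativity bounds the
    row by the limit of [T]. *)
Lemma square_sum_row_cvg n : cvgn (t n).
Proof.
apply: (@nondecreasing_le_cvgn _ (limn T)) => // i.
apply: le_trans (T_le (maxn n.+1 i)).
apply: le_trans (partial_sum_le (leq_maxl n.+1 i)).
rewrite big_nat_recr//= (le_trans (t_nd n (leq_maxr n.+1 i)))//.
by rewrite lerDr sumr_ge0.
Qed.

Hypothesis sF : forall n, s n @ \oo --> F n.

Let G n := limn (t n).

Let G_cvg n : t n @ \oo --> G n.
Proof. exact: square_sum_row_cvg. Qed.

Let F_dist n i : `|F n - s n i| <= G n - t n i.
Proof.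
have l_cvg : `|s n j - s n i| @[j --> \oo] --> `|F n - s n i|.
  by apply: cvg_norm; apply: cvgB => //; exact: cvg_cst.
have r_cvg : t n j - t n i @[j --> \oo] --> G n - t n i.
  by apply: cvgB => //; exact: cvg_cst.
by apply: (ler_cvg_to l_cvg r_cvg); exists i => // j ij; exact: st.
Qed.

Let G_ge0 n : 0 <= G n.
Proof. by have := F_dist n 0%N; rewrite t0 subr0; exact: le_trans. Qed.

Let G_nd : nondecreasing_seq (series G).
Proof. by apply/nondecreasing_seqP => n; rewrite seriesSr lerDl. Qed.

Let series_G_le N : series G N <= limn T.
Proof.
have sum_cvg : \sum_(0 <= n < N) t n M @[M --> \oo] --> series G N.
  by apply: cvg_big => [|n _]; [exact: add_continuous|exact: G_cvg].
apply: (cvgr_to_le sum_cvg); exists N => // M NM.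
exact: le_trans (partial_sum_le NM) (T_le M).
Qed.

Let series_G_cvg : cvgn (series G).
Proof. exact: nondecreasing_le_cvgn series_G_le. Qed.

Let T_le_series_G M : T M <= series G M.
Proof.
by apply: ler_sum => n _; rewrite -subr_ge0 (le_trans _ (F_dist n M)).
Qed.

Let series_G_T : series G M - T M @[M --> \oo] --> 0.
Proof.
(* The bounds [T M <= series G M <= limn T] force the two limits to agree. *)
have -> : 0 = limn (series G) - limn T.
  apply/eqP; rewrite eq_sym subr_eq0 eq_le; apply/andP; split.
    by apply: limr_le => //; apply: nearW.
  by apply: ler_lim => //; apply: nearW.
exact: cvgB.
Qed.

Lemma square_sum_abs_cvg : cvgn (series (fun n => `|F n|)).
Proof.
apply: (series_le_cvg _ _ _ series_G_cvg) => // n.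
by have := F_dist n 0%N; rewrite s0 t0 !subr0.
Qed.

(** By [F_dist], summing whole rows instead of the square changes the result by at most
    [series G M - T M], which tends to 0. *)
Lemma square_sum_cvg l : series F @ \oo --> l -> S @ \oo --> l.
Proof.
move=> Fl; rewrite -[l]subr0.
have -> : S = fun M => series F M - (series F M - S M).
  by apply/funext => M; rewrite opprB addrC subrK.
apply: cvgB => //; apply: norm_cvg0.
apply: (squeeze_cvgr _ (cvg_cst 0) series_G_T); apply: nearW => M.
rewrite normr_ge0/= /series/= /S /T -!sumrB.
by rewrite (le_trans (ler_norm_sum _ _ _))// ler_sum.
Qed.

End DoubleSeries.
End RealLine.

(** * Approximating pairs, linearity and monotonicity of the given integral *)

Section DaniellExtension.
Variables (R : realType) (X : Type) (U : set (X -> R)) (I : (X -> R) -> R).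
Implicit Types (f g : X -> R) (s t fs : nat -> X -> R).

(* [s] plays the role of the partial sums of an expansion of [f], and [t] that
   of the partial sums of its absolute values; unlike an expansion, a pair
   [(s, t)] is stable under pointwise Lipschitz operations. *)
Record approximates f s t : Prop := {
  approx_mem : forall n, U (s n) ;
  approx_dom_mem : forall n, U (t n) ;
  approx0 : s 0%N = 0 ;
  approx_dom0 : t 0%N = 0 ;
  approx_dist : forall m n x, (m <= n)%N ->
    `|s n x - s m x| <= t n x - t m x ;
  approx_summable : cvgn (I \o t) ;
  approx_cvg : forall x, cvgn (t ^~ x) -> s ^~ x @ \oo --> f x }.

Hypothesis hU : is_daniell_space U I.
Let rU := daniell_riesz hU.
Let U0 := riesz0 rU.
Let UD := rieszD rU.
Let UZ := rieszZ rU.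

Let UN f : U f -> U (- f).
Proof. by move=> Uf; rewrite -scaleN1r; exact: UZ. Qed.

Let UB f g : U f -> U g -> U (f - g).
Proof. by move=> Uf Ug; apply: UD => //; exact: UN. Qed.

Let U_norm f : U f -> U (fun x => `|f x|).
Proof.
move=> Uf; have -> : (fun x => `|f x|) = f \max (- f).
  by apply/funext => x; rewrite -maxrN.
by apply: riesz_max => //; exact: UN.
Qed.

Let U_sum (J : Type) (r : seq J) (F : J -> X -> R) :
  (forall i, U (F i)) -> U (\sum_(i <- r) F i).
Proof. by move=> UF; elim/big_rec: _ => // i g _ Ug; exact: UD. Qed.

Let ID := daniellD hU.
Let IZ := daniellZ hU.

Let I0 : I 0 = 0.
Proof. by rewrite -(scale0r 0) IZ// mul0r. Qed.

Let IN f : U f -> I (- f) = - I f.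
Proof. by move=> Uf; rewrite -scaleN1r IZ// mulN1r. Qed.

Let IB f g : U f -> U g -> I (f - g) = I f - I g.
Proof. by move=> Uf Ug; rewrite ID// ?IN//; exact: UN. Qed.

Let I_sum (J : Type) (r : seq J) (F : J -> X -> R) :
  (forall i, U (F i)) -> I (\sum_(i <- r) F i) = \sum_(i <- r) I (F i).
Proof.
move=> UF; elim: r => [|i r IHr]; first by rewrite !big_nil I0.
by rewrite !big_cons ID// ?IHr//; exact: U_sum.
Qed.

Let I_le f g : U f -> U g -> (forall x, f x <= g x) -> I f <= I g.
Proof.
move=> Uf Ug fg; rewrite -subr_ge0 -IB//; apply: (daniell_ge0 hU).
  exact: UB.
by move=> x; rewrite subr_ge0; exact: fg.
Qed.

Let I_dist f g h : U f -> U g -> U h -> (forall x, `|f x - g x| <= h x) ->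
  `|I f - I g| <= I h.
Proof.
move=> Uf Ug Uh fgh; rewrite -IB// ler_norml; apply/andP; split.
  rewrite -IN//; apply: I_le => //; [exact: UN|exact: UB|move=> x].
  by have := fgh x; rewrite ler_norml => /andP[].
apply: I_le => //; [exact: UB|move=> x].
by have := fgh x; rewrite ler_norml => /andP[].
Qed.

Lemma daniell_le_of_dominated f t C : U f -> (forall n, U (t n)) ->
  (forall x, nondecreasing_seq (t ^~ x)) ->
  (forall x, cvgn (t ^~ x) -> f x <= limn (t ^~ x)) ->
  (forall n, I (t n) <= C) -> I f <= C.
Proof.
move=> Uf Ut t_nd ft tC; pose h n := (f - t n) \max 0.
have Uh n : U (h n) by apply: riesz_max => //; exact: UB.
have h_cvg0 : I \o h @ \oo --> (0 : R).
  apply: (daniell_cvg0 hU) => // x.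
    move=> m n mn; apply: le_max2 => //=.
    by rewrite lerD2l lerN2; exact: t_nd.
  (* If [t] reaches [f x], then [h] vanishes from there on. Otherwise [f x] bounds [t], which
     converges to a limit at least [f x], and [h n x] is at most the distance to that limit. *)
  have [[N fN]|/forallNP f_gt] := pselect (exists N, f x <= t N x).
    apply: cvg_near_cst; exists N => // n /= Nn.
    by apply/max_idPr; rewrite subr_le0 (le_trans fN)//; exact: t_nd.
  have t_cvg : cvgn (t ^~ x).
    apply: (nondecreasing_le_cvgn (C := f x)) => // n.
    by rewrite ltW// real_ltNge ?num_real//; apply/negP; exact: f_gt.
  have lim0 : limn (t ^~ x) - t n x @[n --> \oo] --> (0 : R).
    by rewrite -[0](subrr (limn (t ^~ x))); apply: cvgB => //; exact: cvg_cst.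
  apply: (squeeze_cvgr _ (cvg_cst 0) lim0); apply: nearW => n.
  rewrite /h/= le_max lexx orbT/= ge_max lerD2r ft//= subr_ge0.
  exact: nondecreasing_cvgn_le.
have Ch_cvg : C + I (h n) @[n --> \oo] --> C.
  by rewrite -[X in _ --> X]addr0; apply: cvgD => //; exact: cvg_cst.
apply: (cvgr_to_ge Ch_cvg); apply: nearW => n.
(* Pointwise [f <= t n + h n], so [I f] is at most [C + I (h n)]. *)
apply: le_trans (_ : I (t n + h n) <= _); last by rewrite ID// lerD2r.
apply: I_le => //; [exact: UD|move=> x].
by rewrite -lerBlDl /h/= le_max lexx.
Qed.

(** * Integrals along an approximation *)

Section Approximation.
Variables (f : X -> R) (s t : nat -> X -> R).
Hypothesis f_st : approximates f s t.

Let Us := approx_mem f_st.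
Let Ut := approx_dom_mem f_st.

Lemma approx_dom_nd x : nondecreasing_seq (t ^~ x).
Proof.
by move=> m n mn; rewrite -subr_ge0 (le_trans _ (approx_dist f_st x mn)).
Qed.

Lemma approx_dom_ge0 n x : 0 <= t n x.
Proof. by have := approx_dom_nd x (leq0n n); rewrite (approx_dom0 f_st). Qed.

Lemma approx_int_dist m n : (m <= n)%N ->
  `|I (s n) - I (s m)| <= I (t n) - I (t m).
Proof.
move=> mn; rewrite -[leRHS]IB//; apply: I_dist => //; first exact: UB.
by move=> x; exact: (approx_dist f_st).
Qed.

Lemma approx_int_dom_nd : nondecreasing_seq (I \o t).
Proof. by move=> m n mn; apply: I_le => // x; exact: approx_dom_nd. Qed.

Lemma approx_int_dom_le n : I (t n) <= limn (I \o t).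
Proof.
exact: (nondecreasing_cvgn_le approx_int_dom_nd (approx_summable f_st)).
Qed.

(** The sum of [I \o s] and [I \o t] is nondecreasing, and bounded because
    [|I (s n)| <= I (t n)]. *)
Lemma approx_int_cvg : cvgn (I \o s).
Proof.
have -> : I \o s = (fun n => (I (s n) + I (t n)) - I (t n)).
  by apply/funext => n; rewrite addrK.
apply: is_cvgB; last exact: approx_summable f_st.
apply: (nondecreasing_le_cvgn (C := limn (I \o t) + limn (I \o t))).
  move=> m n /approx_int_dist; rewrite ler_norml => /andP[+ _] /=; lra.
move=> n; rewrite lerD ?approx_int_dom_le//.
rewrite (le_trans _ (approx_int_dom_le n))//.
have := approx_int_dist (leq0n n).
rewrite (approx0 f_st) (approx_dom0 f_st) I0 !subr0.
by apply: le_trans; exact: ler_norm.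
Qed.

(** Where [t] converges, [- s n x <= f x - s n x <= \lim_k t k x - t n x]. Hence [- I (s n)] is at
    most the remainder of [I \o t], which tends to 0. *)
Lemma approx_int_ge0 : (forall x, 0 <= f x) -> 0 <= limn (I \o s).
Proof.
move=> f0; have tail n : limn (I \o t) - I (t n) >= - I (s n).
  rewrite -IN//.
  apply: (@daniell_le_of_dominated _ (fun k => t (k + n)%N - t n)).
  - exact: UN.
  - by move=> k; exact: UB.
  - move=> x i j ij; rewrite lerD2r; apply: approx_dom_nd.
    by rewrite leq_add2r.
  - move=> x u_cvg.
    have u_nd : nondecreasing_seq (fun k => t (k + n)%N x - t n x).
      by move=> i j ij; rewrite lerD2r; apply: approx_dom_nd; rewrite leq_add2r.
    have t_cvg : cvgn (t ^~ x).
      apply: (nondecreasing_le_cvgn (C := t n x + limn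
          (fun k => t (k + n)%N x - t n x))); first exact: approx_dom_nd.
      move=> k; rewrite -lerBlDl.
      apply: le_trans (nondecreasing_cvgn_le u_nd u_cvg k).
      by rewrite lerD2r; apply: approx_dom_nd; exact: leq_addr.
    have s_cvg : s (k + n)%N x @[k --> \oo] --> f x.
      by rewrite (cvg_shiftn n (s ^~ x)); exact: approx_cvg t_cvg.
    set l := limn _; have us_cvg :
        t (k + n)%N x - t n x - s (k + n)%N x @[k --> \oo] --> l - f x.
      exact: cvgB.
    (* Nonnegativity of [f] enters here, as [l - f x <= l]; the other half is the limit in [k] of
       [approx_dist] between [n] and [k + n]. *)
    apply: (@le_trans _ _ (l - f x)); last by rewrite lerBlDr lerDl.
    apply: (cvgr_to_ge us_cvg); apply: nearW => k /=.
    have /(_ x) := approx_dist f_st (m := n) (n := (k + n)%N) _ (leq_addl k n).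
    by rewrite ler_norml => /andP[_] /=; rewrite !fctE/=; lra.
  - by move=> k; rewrite IB// lerD2r approx_int_dom_le.
have tail_cvg : limn (I \o t) - I (t n) @[n --> \oo] --> (0 : R).
  rewrite -[0](subrr (limn (I \o t))); apply: cvgB; first exact: cvg_cst.
  exact: approx_summable f_st.
rewrite -oppr_le0 -limN; last exact: approx_int_cvg.
apply: ler_cvg_to tail_cvg (nearW _ tail).
by apply: is_cvgN; exact: approx_int_cvg.
Qed.


End Approximation.
(** One statement serves sums, differences, multiples, absolute values, [max] and [min]: the
    Lipschitz bound turns domination of both arguments into domination of the result. *)
Lemma approx_lipschitz (op : R -> R -> R) C f g s t s' t' :
  0 < C -> op 0 0 = 0 ->
  (forall a b c d, `|op a b - op c d| <= C * (`|a - c| + `|b - d|)) ->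
  (forall u v, U u -> U v -> U (fun x => op (u x) (v x))) ->
  approximates f s t -> approximates g s' t' ->
  approximates (fun x => op (f x) (g x))
    (fun n x => op (s n x) (s' n x)) (fun n => C *: (t n + t' n)).
Proof.
move=> C0 op0 op_lip Uop f_st g_st.
have [Us Ut s0 t0 st It s_cvg] := f_st.
have [Us' Ut' s'0 t'0 st' It' s'_cvg] := g_st.
(* Convergence of the combined bound must give that of [t] and of [t'] separately; monotonicity and
   nonnegativity make this possible. *)
have dom_cvg (a b : nat -> R) : (forall n, 0 <= b n) -> nondecreasing_seq a ->
    cvgn (fun n => C * (a n + b n)) -> cvgn a.
  move=> b0 a_nd /cvg_seq_bounded/bounded_fun_has_ubound[M abM].
  apply: (nondecreasing_le_cvgn (C := C^-1 * M)) => // n.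
  rewrite ler_pdivlMl//; apply: le_trans (_ : C * (a n + b n) <= M).
    by rewrite ler_pM2l// lerDl.
  by apply: abM; exists n.
split.
- by move=> n; exact: Uop.
- by move=> n; apply: UZ; exact: UD.
- by apply/funext => x; rewrite s0 s'0.
- by rewrite t0 t'0 addr0 scaler0.
- move=> m n x mn; apply: le_trans (op_lip _ _ _ _) _.
  rewrite !fctE/= -mulrBr ler_pM2l// opprD addrACA.
  by rewrite lerD// ?st// st'.
- have -> : I \o (fun n => C *: (t n + t' n)) =
      (fun n => C * (I (t n) + I (t' n))).
    by apply/funext => n /=; rewrite IZ ?ID//; exact: UD.
  by apply: is_cvgM; [exact: is_cvg_cst|exact: is_cvgD].
move=> x tt'_cvg.
have t_cvg : cvgn (t ^~ x).
  apply: dom_cvg tt'_cvg => [n|]; first exact: approx_dom_ge0 g_st n x.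
  exact: approx_dom_nd f_st x.
have t'_cvg : cvgn (t' ^~ x).
  apply: (dom_cvg _ (t ^~ x)) => [n||]; first exact: approx_dom_ge0 f_st n x.
    exact: approx_dom_nd g_st x.
  by under eq_fun do rewrite addrC.
have dist_cvg : C * (`|s n x - f x| + `|s' n x - g x|) @[n --> \oo] --> (0 : R).
  rewrite -[0](mulr0 C); apply: cvgM; first exact: cvg_cst.
  rewrite -[0](addr0 0); apply: cvgD.
    apply/norm_cvg0P; rewrite -[0](subrr (f x)).
    by apply: cvgB; [exact: s_cvg|exact: cvg_cst].
  apply/norm_cvg0P; rewrite -[0](subrr (g x)).
  by apply: cvgB; [exact: s'_cvg|exact: cvg_cst].
apply/subr_cvg0; apply: norm_cvg0.
apply: (squeeze_cvgr _ (cvg_cst 0) dist_cvg); apply: nearW => n.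
by rewrite normr_ge0/=.
Qed.

(** * Expansions versus approximations, and independence of the integral *)

Lemma expansion_approx f fs : expansion U I f fs ->
  approximates f (fun n => \sum_(0 <= k < n) fs k)
    (fun n => \sum_(0 <= k < n) (fun x => `|fs k x|)).
Proof.
move=> [Ufs If fs_cvg]; have Uabs n : U (fun x => `|fs n x|) by exact: U_norm.
split.
- by move=> n; exact: U_sum.
- by move=> n; exact: U_sum.
- by rewrite big_geq.
- by rewrite big_geq.
- move=> m n x mn; rewrite !fct_sumE.
  have := sub_series_geq (fs ^~ x) mn; rewrite /series/= => ->.
  have := sub_series_geq (fun k => `|fs k x|) mn; rewrite /series/= => ->.
  exact: ler_norm_sum.
- have -> // : I \o (fun n => \sum_(0 <= k < n) (fun x => `|fs k x|)) =
    series (fun n => I (fun x => `|fs n x|)).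
  by apply/funext => n /=; rewrite I_sum.
- move=> x; have -> : (fun n => (\sum_(0 <= k < n) (fun x => `|fs k x|)) x) =
    series (fun n => `|fs n x|) by apply/funext => n; rewrite fct_sumE.
  move=> /fs_cvg; have -> // : series (fs ^~ x) =
    (fun n => (\sum_(0 <= k < n) fs k) x).
  by apply/funext => n; rewrite fct_sumE.
Qed.

Lemma expansion_intE f fs : expansion U I f fs ->
  I \o (fun n => \sum_(0 <= k < n) fs k) = series (I \o fs).
Proof.
by move=> [Ufs _ _]; apply/funext => n /=; rewrite I_sum.
Qed.

(** Subtraction is Lipschitz, so [approx_int_ge0] applies to the difference. With [f = g], used in
    both directions, this gives independence of the approximation. *)
Lemma approx_int_le f g s t s' t' :
  approximates f s t -> approximates g s' t' ->
  (forall x, f x <= g x) -> limn (I \o s) <= limn (I \o s').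
Proof.
move=> f_st g_st fg.
have gf_st : approximates (fun x => g x - f x) (fun n x => s' n x - s n x)
    (fun n => 1 *: (t' n + t n)).
  apply: (@approx_lipschitz (fun a b => a - b)) => //.
  - by rewrite subr0.
  - move=> a b c d; rewrite mul1r.
    have -> : a - b - (c - d) = (a - c) - (b - d) by lra.
    exact: ler_normB.
rewrite -subr_ge0 -limB;
  last exact: approx_int_cvg f_st; last exact: approx_int_cvg g_st.
have -> : (I \o s') - (I \o s) = I \o (fun n x => s' n x - s n x).
  apply/funext => n; rewrite !fctE/= -IB//; first exact: approx_mem g_st _.
  exact: approx_mem f_st _.
by apply: approx_int_ge0 gf_st _ => x; rewrite subr_ge0.
Qed.

(** The increments of [s] alone would not do: they may be absolutely summable at a point where [t]
    diverges, and there [s] need not tend to [f]. *)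
Lemma approx_expansion f s t : approximates f s t ->
  exists fs, expansion U I f fs.
Proof.
move=> f_st; have [Us Ut s0 t0 st It s_cvg] := f_st.
pose ds n := s n.+1 - s n; pose dt n := t n.+1 - t n.
(* The terms [dt] make [\sum |fs n x|] control [\sum dt n x], and they
   cancel out in the partial sums. *)
pose fs n := if odd n then dt n./2 else ds n./2 - dt n./2.
have Uds n : U (ds n) by exact: UB.
have Udt n : U (dt n) by exact: UB.
have Ufs n : U (fs n) by rewrite /fs; case: ifP => // _; exact: UB.
have dsdt n x : `|ds n x| <= dt n x by exact: st.
have dt_ge0 n x : 0 <= dt n x by exact: le_trans (dsdt n x).
have dsE n x : ds n x = s n.+1 x - s n x by [].
have dtE n x : dt n x = t n.+1 x - t n x by [].
have fs_odd n : fs n.*2.+1 = dt n by rewrite /fs/= odd_double uphalf_double.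
have fs_even n x : fs n.*2 x = ds n x - dt n x.
  by rewrite /fs odd_double doubleK.
have even_sum n x : series (fs ^~ x) n.*2 = s n x.
  elim: n => [|n IHn]; first by rewrite /series/= big_geq// s0.
  by rewrite doubleS 2!seriesSr IHn fs_odd fs_even dsE -addrA subrK addrC subrK.
(* The constant comes from [|ds - dt| + dt <= |ds| + 2 dt <= 3 dt]. *)
have abs_le n x : `|fs n.*2 x| + `|fs n.*2.+1 x| <= 3 * (t n.+1 x - t n x).
  rewrite fs_odd fs_even (ger0_norm (dt_ge0 n x)).
  have := dsdt n x; have := ler_normB (ds n x) (dt n x).
  rewrite (ger0_norm (dt_ge0 _ _)) dtE; lra.
have series_abs_nd x : nondecreasing_seq (series (fun n => `|fs n x|)).
  exact: nondecreasing_normr_series.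
split with fs; split => //.
- pose u n := I (fun x => `|fs n x|); rewrite -/u.
  have Uabs n : U (fun x => `|fs n x|) by exact: U_norm.
  have u_ge0 n : 0 <= u n by exact: (daniell_ge0 hU).
  apply: (nondecreasing_le_cvgn (C := 3 * limn (I \o t))).
    by apply/nondecreasing_seqP => n; rewrite seriesSr lerDl.
  have even_le n : series u n.*2 <= 3 * I (t n).
    elim: n => [|n IHn]; first by rewrite /series/= big_geq// t0 I0 mulr0.
    rewrite doubleS 2!seriesSr -addrA.
    have : u n.*2 + u n.*2.+1 <= 3 * (I (t n.+1) - I (t n)).
      rewrite -ID// -IB// -IZ; last exact: UB.
      apply: I_le => [| |x]; [exact: UD|by apply: UZ; exact: UB|].
      exact: abs_le.
    by move: IHn; lra.
  move=> n; apply: le_trans (_ : series u n.*2 <= _).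
    rewrite -addnn series_addn lerDl sumr_ge0//.
  rewrite (le_trans (even_le n))// ler_pM2l//.
  exact: approx_int_dom_le f_st n.
move=> x abs_cvg.
have t_cvg : cvgn (t ^~ x).
  apply: (nondecreasing_le_cvgn (C := limn (series (fun n => `|fs n x|)))).
    exact: approx_dom_nd f_st x.
  move=> n; apply: le_trans (nondecreasing_cvgn_le _ abs_cvg n.*2); last first.
    exact: series_abs_nd.
  elim: n => [|n IHn]; first by rewrite /series/= big_geq// t0.
  rewrite doubleS 2!seriesSr fs_odd (ger0_norm (dt_ge0 _ _)) dtE.
  by have := normr_ge0 (fs n.*2 x); move: IHn; lra.
have sx_cvg := s_cvg _ t_cvg.
(* Even partial sums are [s n x]; odd ones are [s n.+1 x - dt n x], with the same limit because [t]
   converges at [x]. *)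
apply: cvg_even_odd; first by under eq_fun do rewrite even_sum.
have -> : (fun n => series (fs ^~ x) n.*2.+1) =
    (fun n => s n.+1 x - (t n.+1 x - t n x)).
  by apply/funext => n; rewrite seriesSr even_sum fs_even dsE dtE; lra.
rewrite -[f x]subr0 -(subrr (limn (t ^~ x))).
apply: cvgB; first by rewrite (cvg_shiftS (s ^~ x)).
by apply: cvgB => //; rewrite (cvg_shiftS (t ^~ x)).
Qed.

(** [get] returns the sum along some expansion; comparing that expansion with [(s, t)] in both
    directions identifies the limits. *)
Lemma approx_int f s t : approximates f s t -> I \o s @ \oo --> ext_int U I f.
Proof.
move=> f_st; have [fs ffs] := approx_expansion f_st.
rewrite /ext_int; set A := (X in get X).
have [gs fgs ->] : A (get A).
  by apply: getPex; exists (limn (series (I \o fs))), fs.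
rewrite -(expansion_intE fgs); have fgs' := expansion_approx fgs.
have <- : limn (I \o s) = limn (I \o (fun n => \sum_(0 <= k < n) gs k)).
  apply/eqP; rewrite eq_le (approx_int_le f_st fgs')//.
  by rewrite (approx_int_le fgs' f_st).
exact: approx_int_cvg f_st.
Qed.

(** * The extended integral and termwise integration *)

Local Notation J := (ext_int U I).
Local Notation U' := (ext_space U I).

Lemma ext_space_approx f : U' f -> exists s t, approximates f s t.
Proof. by move=> [fs /expansion_approx ffs]; do 2 eexists; exact: ffs. Qed.

Lemma approx_ext_space f s t : approximates f s t -> U' f.
Proof. exact: approx_expansion. Qed.

Lemma approx_int_eq f s t l :
  approximates f s t -> I \o s @ \oo --> l -> J f = l.
Proof.
by move=> /approx_int sJ sl; apply: cvg_unique sJ sl; exact: Rhausdorff.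
Qed.

Lemma approx_norm f s t : approximates f s t ->
  approximates (fun x => `|f x|) (fun n x => `|s n x|)
    (fun n => 1 *: (t n + t n)).
Proof.
move=> f_st.
apply: (approx_lipschitz (op := fun a _ => `|a|) _ _ _ _ f_st f_st) => //.
- by rewrite normr0.
- move=> a b c d; rewrite mul1r (le_trans (ler_dist_dist _ _))//.
  by rewrite lerDl.
- by move=> u v Uu _; exact: U_norm.
Qed.

Lemma ext_int_ge0 f : U' f -> (forall x, 0 <= f x) -> 0 <= J f.
Proof.
move=> /ext_space_approx[s [t f_st]] f0.
rewrite (approx_int_eq f_st (approx_int_cvg f_st)).
exact: approx_int_ge0 f_st f0.
Qed.

(* Merging the first [N] terms of an expansion into a single one brings
   [\sum I |fs n|] arbitrarily close to the integral of [|f|]. *)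
Lemma approx_sharp f e : U' f -> 0 < e ->
  exists s t, approximates f s t /\
    forall n, I (t n) <= J (fun x => `|f x|) + e.
Proof.
move=> /ext_space_approx[s [t f_st]] e0.
have [Us Ut s0 t0 st It s_cvg] := f_st.
have bound_cvg : I (fun x => `|s n x|) + (limn (I \o t) - I (t n))
    @[n --> \oo] --> J (fun x => `|f x|).
  rewrite -[J _]addr0; apply: cvgD; first exact: approx_int (approx_norm f_st).
  by rewrite -(subrr (limn (I \o t))); apply: cvgB => //; exact: cvg_cst.
(* The merged term [s N] costs [I |s N|], and the later terms cost at most the remainder of
   [I \o t]. *)
have [N _ boundN] : \forall n \near \oo,
    I (fun x => `|s n x|) + (limn (I \o t) - I (t n)) <=
    J (fun x => `|f x|) + e.
  by apply: (cvgr_le _ bound_cvg); rewrite ltrDl.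
(* Index 0 keeps the value 0 required by [approx0]; the first increment is then all of [s N]. *)
pose s' n := if n is k.+1 then s (k + N)%N else 0.
pose t' n : X -> R := if n is k.+1
  then (fun x => `|s N x|) + (t (k + N)%N - t N) else 0.
have UsN : U (fun x => `|s N x|) by exact: U_norm.
have t'Sx k x : t' k.+1 x = `|s N x| + (t (k + N)%N x - t N x) by [].
exists s', t'; split; last first.
  move=> [|k] /=.
    rewrite I0; apply: addr_ge0; last exact: ltW.
    by apply: ext_int_ge0 => //; exact: approx_ext_space (approx_norm f_st).
  rewrite ID//; last exact: UB.
  rewrite IB// (le_trans _ (boundN N _))//= lerD2l lerD2r.
  exact: approx_int_dom_le f_st _.
split => //.
- by move=> [|k]; [exact: U0|exact: Us].
- by move=> [|k]; [exact: U0|]; apply: UD => //; exact: UB.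
- move=> [|m] [|n] x //= mn; first by rewrite !subrr normr0.
    rewrite -/(t' n.+1) t'Sx !subr0.
    have := st N (n + N)%N x (leq_addl _ _).
    have := ler_normD (s N x) (s (n + N)%N x - s N x).
    by rewrite addrC subrK; lra.
  rewrite -/(t' n.+1) -/(t' m.+1) !t'Sx.
  have := st (m + N)%N (n + N)%N x; rewrite leq_add2r => /(_ mn); lra.
- have : I (fun x => `|s N x|) + (I (t (k + N)%N) - I (t N)) @[k --> \oo] -->
      I (fun x => `|s N x|) + (limn (I \o t) - I (t N)).
    apply: cvgD; first exact: cvg_cst.
    apply: cvgB; last exact: cvg_cst.
    by rewrite (cvg_shiftn N (I \o t)).
  have -> : (fun k => I (fun x => `|s N x|) + (I (t (k + N)%N) - I (t N))) =
      (fun k => I (t' k.+1)).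
    by apply/funext => k /=; rewrite ID ?IB//; exact: UB.
  by rewrite (cvg_shiftS (I \o t')) => /cvgP.
move=> x t'_cvg; rewrite -(cvg_shiftS (s' ^~ x))/=.
rewrite (cvg_shiftn N (s ^~ x)); apply: s_cvg.
have : t' k.+1 x - (`|s N x| - t N x) @[k --> \oo] -->
    limn (t' ^~ x) - (`|s N x| - t N x).
  by apply: cvgB; [rewrite (cvg_shiftS (t' ^~ x))|exact: cvg_cst].
have -> : (fun k => t' k.+1 x - (`|s N x| - t N x)) = (fun k => t (k + N)%N x).
  by apply/funext => k; rewrite t'Sx; lra.
by rewrite (cvg_shiftn N (t ^~ x)) => /cvgP.
Qed.

(** The lemmas on squares are used twice: at each point, to see that [S] tends to [F], and on the
    integrals [I (s n k)], to compute [J F]. *)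
Lemma ext_expansion F Fs : expansion U' J F Fs ->
  U' F /\ series (J \o Fs) @ \oo --> J F.
Proof.
move=> [UFs JFs Fs_cvg].
have /choice[st stP] n : exists st : (nat -> X -> R) * (nat -> X -> R),
    approximates (Fs n) st.1 st.2 /\
    forall k, I (st.2 k) <= J (fun x => `|Fs n x|) + 2^-1 ^+ n.
  have e0 : 0 < 2^-1 ^+ n :> R by rewrite exprn_gt0// invr_gt0.
  have [s [t Fst]] := approx_sharp (UFs n) e0.
  by exists (s, t).
pose s n := (st n).1; pose t n := (st n).2.
have Fst n : approximates (Fs n) (s n) (t n) by have [] := stP n.
pose S M := \sum_(0 <= n < M) s n M; pose T M := \sum_(0 <= n < M) t n M.
have Us n k : U (s n k) := approx_mem (Fst n) k.
have Ut n k : U (t n k) := approx_dom_mem (Fst n) k.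
have sx0 x n : s n 0%N x = 0 by rewrite (approx0 (Fst n)).
have tx0 x n : t n 0%N x = 0 by rewrite (approx_dom0 (Fst n)).
have stx x n i j : (i <= j)%N -> `|s n j x - s n i x| <= t n j x - t n i x.
  exact: approx_dist (Fst n) _ _ x.
have Is0 n : I (s n 0%N) = 0 by rewrite (approx0 (Fst n)) I0.
have It0 n : I (t n 0%N) = 0 by rewrite (approx_dom0 (Fst n)) I0.
have Ist n i j : (i <= j)%N ->
    `|I (s n j) - I (s n i)| <= I (t n j) - I (t n i).
  exact: approx_int_dist (Fst n) _ _.
have ISE : I \o S = fun M => \sum_(0 <= n < M) I (s n M).
  by apply/funext => M /=; rewrite I_sum.
have ITE : I \o T = fun M => \sum_(0 <= n < M) I (t n M).
  by apply/funext => M /=; rewrite I_sum.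
have SE x : S ^~ x = fun M => \sum_(0 <= n < M) s n M x.
  by apply/funext => M; rewrite /S fct_sumE.
have TE x : T ^~ x = fun M => \sum_(0 <= n < M) t n M x.
  by apply/funext => M; rewrite /T fct_sumE.
have IT_cvg : cvgn (fun M => \sum_(0 <= n < M) I (t n M)).
  (* Sharpness bounds row [n] of the integrals by [b n]; the geometric tolerances keep [b]
     summable. *)
  pose b n := J (fun x => `|Fs n x|) + 2^-1 ^+ n.
  have It_ge0 n k : 0 <= I (t n k).
    apply: (daniell_ge0 hU) => // x; exact: approx_dom_ge0 (Fst n) k x.
  have b_cvg : cvgn (series b).
    have -> : b = (fun n => J (fun x => `|Fs n x|)) + geometric 1 2^-1.
      by apply/funext => n; rewrite fctE /geometric/= mul1r.
    apply: is_cvg_seriesD => //; apply: is_cvg_geometric_series.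
    by rewrite ger0_norm// invf_lt1// ltr1n.
  have b_nd : nondecreasing_seq (series b).
    apply/nondecreasing_seqP => n; rewrite seriesSr lerDl.
    by have [_ /(_ 0%N)] := stP n; apply: le_trans; exact: It_ge0.
  apply: (nondecreasing_le_cvgn (C := limn (series b))).
    move=> i j ij; rewrite -subr_ge0.
    exact: le_trans (square_sum_dist Is0 It0 Ist ij).
  move=> M; apply: le_trans (nondecreasing_cvgn_le b_nd b_cvg M).
  by apply: ler_sum => n _; have [_] := stP n; exact.
have FST : approximates F S T.
  split.
  - by move=> M; exact: U_sum.
  - by move=> M; exact: U_sum.
  - by rewrite /S big_geq.
  - by rewrite /T big_geq.
  - move=> m n x mn; rewrite /S /T !fct_sumE.
    exact: (square_sum_dist (s := fun n k => s n k x) (sx0 x) (tx0 x)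
      (stx x)).
  - by rewrite ITE.
  move=> x; rewrite SE TE => Tx_cvg.
  have sFx n : s n ^~ x @ \oo --> Fs n x.
    apply: (approx_cvg (Fst n)).
    exact: (square_sum_row_cvg (s := fun n k => s n k x) (sx0 x) (tx0 x)
      (stx x)).
  apply: (square_sum_cvg (s := fun n k => s n k x) (sx0 x) (tx0 x) (stx x)
    Tx_cvg sFx).
  apply: Fs_cvg.
  exact: (square_sum_abs_cvg (s := fun n k => s n k x) (sx0 x) (tx0 x) (stx x)
    Tx_cvg sFx).
split; first exact: approx_ext_space FST.
have sJ n : I \o s n @ \oo --> J (Fs n) by exact: approx_int (Fst n).
have JFs_cvg : cvgn (series (J \o Fs)).
  apply: normed_cvg.
  exact: (square_sum_abs_cvg (s := fun n k => I (s n k)) Is0 It0 Ist IT_cvg sJ).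
suff -> : J F = limn (series (J \o Fs)) by [].
apply: approx_int_eq FST _; rewrite ISE.
exact: (square_sum_cvg (s := fun n k => I (s n k)) Is0 It0 Ist IT_cvg sJ).
Qed.

(** * The Daniell axioms for the extension *)

Lemma ext_lipschitz (op : R -> R -> R) C f g :
  0 < C -> op 0 0 = 0 ->
  (forall a b c d, `|op a b - op c d| <= C * (`|a - c| + `|b - d|)) ->
  (forall u v, U u -> U v -> U (fun x => op (u x) (v x))) ->
  U' f -> U' g -> U' (fun x => op (f x) (g x)).
Proof.
move=> C0 op0 op_lip Uop.
move=> /ext_space_approx[s [t f_st]] /ext_space_approx[s' [t' g_st]].
exact: approx_ext_space (approx_lipschitz C0 op0 op_lip Uop f_st g_st).
Qed.

Lemma ext_intD f g : U' f -> U' g -> U' (f + g) /\ J (f + g) = J f + J g.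
Proof.
move=> /ext_space_approx[s [t f_st]] /ext_space_approx[s' [t' g_st]].
have fg_st : approximates (f + g) (fun n => s n + s' n)
    (fun n => 1 *: (t n + t' n)).
  apply: (approx_lipschitz (op := +%R) _ _ _ _ f_st g_st) => //.
    by rewrite addr0.
  by move=> a b c d; rewrite mul1r opprD addrACA ler_normD.
split; first exact: approx_ext_space fg_st.
apply: (approx_int_eq fg_st).
have -> : I \o (fun n => s n + s' n) = (fun n => I (s n) + I (s' n)).
  by apply/funext => n /=; rewrite ID//;
    [exact: approx_mem f_st n|exact: approx_mem g_st n].
by apply: cvgD; [exact: approx_int f_st|exact: approx_int g_st].
Qed.

Lemma ext_intZ a f : U' f -> U' (a *: f) /\ J (a *: f) = a * J f.
Proof.
move=> /ext_space_approx[s [t f_st]].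
(* [|a| + 1] replaces [|a|] so that the Lipschitz constant is positive even for [a = 0]. *)
have af_st : approximates (a *: f) (fun n => a *: s n)
    (fun n => (`|a| + 1) *: (t n + t n)).
  apply: (approx_lipschitz (op := fun b _ => a * b) _ _ _ _ f_st f_st).
  - by rewrite ltr_wpDl.
  - by rewrite mulr0.
  - move=> b b' c c'; rewrite -mulrBr normrM ler_pM//; first by rewrite lerDl.
    by rewrite lerDl.
  - by move=> u v Uu _; exact: UZ.
split; first exact: approx_ext_space af_st.
apply: (approx_int_eq af_st).
have -> : I \o (fun n => a *: s n) = (fun n => a * I (s n)).
  by apply/funext => n /=; rewrite IZ//; exact: approx_mem f_st n.
by apply: cvgM; [exact: cvg_cst|exact: approx_int f_st].
Qed.

Lemma ext_intB f g : U' f -> U' g -> U' (f - g) /\ J (f - g) = J f - J g.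
Proof.
move=> U'f U'g; have [U'Ng JNg] := ext_intZ (-1) U'g.
by have := ext_intD U'f U'Ng; rewrite JNg mulN1r scaleN1r.
Qed.

Lemma ext_space_sub f : U f -> U' f /\ J f = I f.
Proof.
(* These are the partial sums of the expansion [f, 0, 0, ...]. *)
move=> Uf; pose s n : X -> R := if n is 0 then 0 else f.
have f_st : approximates f s
    (fun n => if n is 0 then 0 else (fun x => `|f x|)).
  split => //; rewrite /s.
  - by case.
  - by case=> // _; exact: U_norm.
  - move=> [|m] [|n] x //= _; rewrite ?subrr ?normr0 ?subr0//.
  - apply: (@cvgP _ _ (I (fun x => `|f x|))).
    by apply: cvg_near_cst; exists 1%N => // -[].
  - by move=> x _; apply: cvg_near_cst; exists 1%N => // -[].
split; first exact: approx_ext_space f_st.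
apply: (approx_int_eq f_st).
by apply: cvg_near_cst; exists 1%N => // -[].
Qed.

Lemma ext_daniell : is_daniell_space U' J.
Proof.
split.
- exact: daniell_nonempty hU.
- split.
  + by have [] := ext_space_sub U0.
  + by move=> f g U'f U'g; have [] := ext_intD U'f U'g.
  + by move=> a f U'f; have [] := ext_intZ a U'f.
  + move=> f g U'f U'g.
    apply: (ext_lipschitz (op := Num.max) ltr01 _ _ _ U'f U'g).
    - exact: maxxx.
    - exact: max_lipschitz.
    - exact: riesz_max rU.
  + move=> f g U'f U'g.
    apply: (ext_lipschitz (op := Num.min) ltr01 _ _ _ U'f U'g).
    - exact: minxx.
    - exact: min_lipschitz.
    - exact: riesz_min rU.
- by move=> f g U'f U'g; have [] := ext_intD U'f U'g.
- by move=> a f U'f; have [] := ext_intZ a U'f.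
- exact: ext_int_ge0.
move=> fs U'fs fs_ni fs_cvg0; pose h n := fs n - fs n.+1.
have U'h n : U' (h n) by have [] := ext_intB (U'fs n) (U'fs n.+1).
have Jh n : J (h n) = J (fs n) - J (fs n.+1).
  by have [] := ext_intB (U'fs n) (U'fs n.+1).
have h_ge0 n x : 0 <= h n x by rewrite subr_ge0; exact: fs_ni.
have sum_Jh n : series (J \o h) n = J (fs 0%N) - J (fs n).
  elim: n => [|n IHn]; first by rewrite /series/= big_geq// subrr.
  by rewrite seriesSr IHn/= Jh; lra.
have sum_h n x : series (h ^~ x) n = fs 0%N x - fs n x.
  elim: n => [|n IHn]; first by rewrite /series/= big_geq// subrr.
  by rewrite seriesSr IHn; rewrite -[h n x]/(fs n x - fs n.+1 x); lra.
have f0h : expansion U' J (fs 0%N) h.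
  split=> //.
    have -> : (fun n => J (fun x => `|h n x|)) = J \o h.
      apply/funext => n /=; congr J; apply/funext => x.
      by rewrite ger0_norm.
    (* The partial sums are [J (fs 0) - J (fs n)], and [fs n] is nonnegative since it decreases to
       0. *)
    apply: (nondecreasing_le_cvgn (C := J (fs 0%N))).
      apply/nondecreasing_seqP => n; rewrite seriesSr lerDl.
      exact: ext_int_ge0.
    move=> n; rewrite sum_Jh lerBlDr lerDl; apply: ext_int_ge0 => // x.
    have f_cvg : cvgn (fs ^~ x) by apply: cvgP (fs_cvg0 x).
    have := nonincreasing_cvgn_ge (fs_ni x) f_cvg n.
    by rewrite (cvg_lim _ (fs_cvg0 x)).
  move=> x _; have -> : series (h ^~ x) = (fun n => fs 0%N x - fs n x).
    by apply/funext => n; exact: sum_h.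
  by rewrite -[X in _ --> X]subr0; apply: cvgB => //; exact: cvg_cst.
have [_ Jh_cvg] := ext_expansion f0h.
have -> : J \o fs = fun n => J (fs 0%N) - series (J \o h) n.
  by apply/funext => n; rewrite sum_Jh /=; lra.
by rewrite -[0](subrr (J (fs 0%N))); apply: cvgB => //; exact: cvg_cst.
Qed.

End DaniellExtension.

(** As [ext_int] is defined through a choice, the first clause records that it is the sum along
    every expansion. *)
Theorem theorem3p12 (R : realType) (X : Type) (U : set (X -> R))
    (I : (X -> R) -> R) (hU : is_daniell_space U I) :
  [/\ forall f fs, expansion U I f fs ->
        series (I \o fs) @ \oo --> ext_int U I f,
      is_complete_daniell_space (ext_space U I) (ext_int U I),
      U `<=` ext_space U I &
      forall f, U f -> ext_int U I f = I f].
Proof.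
split.
- move=> f fs ffs; rewrite -(expansion_intE hU ffs).
  exact: (approx_int hU (expansion_approx hU ffs)).
- split; first exact: ext_daniell.
  by move=> f fs /(ext_expansion hU)[].
- by move=> f /(ext_space_sub hU)[].
- by move=> f /(ext_space_sub hU)[].
Qed.
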